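(* Let $0<\alpha<1$, with the cut and parametrization fixed as in the context. Let $v\in X_\alpha$ and set $\delta_j=[v]_{t_j^d}$, $j=1,\ldots,n_d$. Then $$v=v_C+J_v,\qquad J_v:=\sum_{j=1}^{n_d}\delta_jG_j,\qquad v_C\in H_\alpha(\Gamma),$$ and this representation of $v$ as the sum of a function in $H_\alpha(\Gamma)$ and a linear combination of $G_1,\ldots,G_{n_d}$ is unique. Moreover, there is a constant $C$, independent of $v$, such that $$\|v_C\|_{H_\alpha(\Gamma)}+\sum_{j=1}^{n_d}|\delta_j|\le C\|v\|_{X_\alpha}.$$
   Context: **Contour.** $\Gamma\subset\mathbb C$ is a simple, closed, positively oriented contour of class $C^2$ with a regular $C^2$, $2\pi$-periodic parametrization $\gamma:\mathbb R\to\Gamma$ (so $\gamma(\theta+2\pi)=\gamma(\theta)$, $\gamma'(\theta)\ne0$, $\gamma$ injective on $[0,2\pi)$). $\mathcal D=\{t_1^d,\ldots,t_{n_d}^d\}\subset\Gamma$, $n_d\ge1$, is a set of distinct points, $t_j^d=\gamma(\theta_j^d)$ with $0<\theta_1^d<\cdots<\theta_{n_d}^d<2\pi$; the point $t_*=\gamma(0)=\gamma(2\pi)\notin\mathcal D$ is the cut. The continuity arcs are the $n_d$ open arcs of $\Gamma\setminus\mathcal D$. For a function $v$ with one-sided limits, $v(t_j^d\pm0)$ denote the limits along the orientation ($-$: incoming, $+$: outgoing), $[v]_{t_j^d}:=v(t_j^d+0)-v(t_j^d-0)$, and functions are represented by incoming values $v(t_j^d)=v(t_j^d-0)$. **Spaces.**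 For $0<\sigma<1$, $X_\sigma=PH_\sigma(\Gamma,\mathcal D)$ is the space of complex functions that are $\sigma$-Hölder on every continuity arc and have finite lateral limits at all points of $\mathcal D$, with norm $\|v\|_{X_\sigma}=\max_I(\|v\|_{\infty,I}+[v]_{\sigma,I})$, the maximum over the continuity arcs $I$; here $\overline I^{\,\ell}$ is $I$ completed by its two endpoints carrying the lateral values, $\|v\|_{\infty,I}=\sup_{\overline I^{\,\ell}}|v|$ and $[v]_{\sigma,I}=\sup_{t\ne s\in\overline I^{\,\ell}}|v(t)-v(s)|/|t-s|^\sigma$. If $n_d=1$, the distance $|t-s|$ in this seminorm is understood as the distance along the (single) completed arc. $H_\sigma(\Gamma)$ is the space of globally $\sigma$-Hölder functions on $\Gamma$ with norm $\sup_\Gamma|v|+\sup_{t\ne s\in\Gamma}|v(t)-v(s)|/|t-s|^\sigma$. **Generators.** For $0\le\theta<2\pi$: $H_j(\gamma(\theta))=0$ if $0\le\theta\le\theta_j^d$ and $=1$ if $\theta_j^d<\theta<2\pi$; $R(\gamma(\theta))=\theta/(2\pi)$; $G_j:=H_j-R$. *)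

(* Defs.v *)
From Stdlib Require Import Reals List.
From Coquelicot Require Import Coquelicot.
Open Scope R_scope.

Definition on_curve (gamma : R -> C) (t : C) : Prop :=
  exists s : R, t = gamma s.

Definition velocity (gamma : R -> C) (s : R) : C :=
  (Derive (fun u => fst (gamma u)) s, Derive (fun u => snd (gamma u)) s).

(* [ex_derive_n f 2] alone speaks only about [Derive f], hence [k <= 2]. *)
Definition C2_function (f : R -> R) : Prop :=
  (forall (k : nat) (s : R), (k <= 2)%nat -> ex_derive_n f k s) /\
  (forall s : R, continuous (Derive_n f 2) s).

(* The union of the bounded components of the complement of the curve: every
   path from [z] that avoids the curve stays in a fixed disc. *)
Definition inside (gamma : R -> C) (z : C) : Prop :=
  ~ on_curve gamma z /\
  exists M : R, forall p : R -> C,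
    (forall s : R, continuous p s) ->
    (forall s : R, 0 <= s <= 1 -> ~ on_curve gamma (p s)) ->
    p 0 = z -> Cmod (p 1) <= M.

(* Winding number 1 around each interior point. *)
Definition positively_oriented (gamma : R -> C) : Prop :=
  forall z : C, inside gamma z ->
    is_RInt (V := C_R_NormedModule)
      (fun s => (velocity gamma s / (gamma s - z))%C) 0 (2 * PI)
      (RtoC (2 * PI) * Ci)%C.

Record contour (gamma : R -> C) : Prop := {
  contour_C2_re : C2_function (fun s => fst (gamma s));
  contour_C2_im : C2_function (fun s => snd (gamma s));
  contour_periodic : forall s : R, gamma (s + 2 * PI) = gamma s;
  contour_regular : forall s : R, velocity gamma s <> 0%C;
  contour_simple : forall s s' : R, 0 <= s < 2 * PI -> 0 <= s' < 2 * PI ->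
    gamma s = gamma s' -> s = s';
  contour_positive : positively_oriented gamma
}.

(* The discontinuity points are [gamma (theta j)], [1 <= j <= n]; values of
   [theta] at other indices are never used. *)
Record discontinuities (n : nat) (theta : nat -> R) : Prop := {
  discontinuities_nonempty : (1 <= n)%nat;
  discontinuities_range : forall j : nat, (1 <= j <= n)%nat ->
    0 < theta j < 2 * PI;
  discontinuities_increasing : forall i j : nat,
    (1 <= i)%nat -> (i < j)%nat -> (j <= n)%nat -> theta i < theta j
}.

(* Functions on the curve are represented by functions [C -> C]; only their
   values on the curve matter. The lateral limits [v (t + 0)] and [v (t - 0)]
   at [t = gamma s] are the following two values when these limits exist. *)
Definition outgoing (gamma : R -> C) (v : C -> C) (s : R) : C :=
  iota (fun l : C_R_CompleteNormedModule =>
          filterlim (fun u => v (gamma u)) (at_right s) (locally l)).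

Definition incoming (gamma : R -> C) (v : C -> C) (s : R) : C :=
  iota (fun l : C_R_CompleteNormedModule =>
          filterlim (fun u => v (gamma u)) (at_left s) (locally l)).

Definition jump (gamma : R -> C) (v : C -> C) (s : R) : C :=
  (outgoing gamma v s - incoming gamma v s)%C.

(* The continuity arc number [j], [1 <= j <= n], is the image of the open
   interval from [theta j] to [arc_end n theta j]; the last arc runs through
   the cut [gamma 0] and ends at [gamma (theta 1)]. *)
Definition arc_end (n : nat) (theta : nat -> R) (j : nat) : R :=
  if Nat.eqb j n then theta 1%nat + 2 * PI else theta (S j).

(* Points of a completed arc are given by their parameters: when [n = 1] the
   two endpoints are distinct points of the completed arc although they have
   the same image in the plane. *)
Definition arc_dist (gamma : R -> C) (n : nat) (a b : R) : R :=
  if Nat.eqb n 1 then Rabs (RInt (fun u => Cmod (velocity gamma u)) a b)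
  else Cmod (gamma a - gamma b)%C.

Definition arc_value (gamma : R -> C) (n : nat) (theta : nat -> R)
    (v : C -> C) (j : nat) (a : R) : C :=
  if Req_EM_T a (theta j) then outgoing gamma v (theta j)
  else if Req_EM_T a (arc_end n theta j)
  then incoming gamma v (arc_end n theta j)
  else v (gamma a).

(* [Rpower 0 sigma] is 1 in Stdlib, whence the conditions [_ <> _] in what
   follows. *)
Record in_X (gamma : R -> C) (n : nat) (theta : nat -> R) (sigma : R)
    (v : C -> C) : Prop := {
  in_X_holder : forall j : nat, (1 <= j <= n)%nat ->
    exists L : R, forall a b : R,
      theta j < a < arc_end n theta j -> theta j < b < arc_end n theta j ->
      a <> b ->
      Cmod (v (gamma a) - v (gamma b)) <=
        L * Rpower (arc_dist gamma n a b) sigma;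
  in_X_outgoing : forall j : nat, (1 <= j <= n)%nat ->
    exists l : C,
      filterlim (fun u => v (gamma u)) (at_right (theta j)) (locally l);
  in_X_incoming : forall j : nat, (1 <= j <= n)%nat ->
    filterlim (fun u => v (gamma u)) (at_left (theta j))
      (locally (v (gamma (theta j))))
}.

(* [Lub_Rbar E] is the supremum in the extended reals, which [real] sends to
   0 when it is infinite; the norms below are used only for members of the
   corresponding spaces, for which the suprema are finite. *)
Definition sup (E : R -> Prop) : R := real (Lub_Rbar E).

Definition arc_norm (gamma : R -> C) (n : nat) (theta : nat -> R) (sigma : R)
    (v : C -> C) (j : nat) : R :=
  sup (fun x => exists a : R,
         theta j <= a <= arc_end n theta j /\
         x = Cmod (arc_value gamma n theta v j a)) +
  sup (fun x => exists a b : R,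
         theta j <= a <= arc_end n theta j /\
         theta j <= b <= arc_end n theta j /\ a <> b /\
         x = Cmod (arc_value gamma n theta v j a -
                   arc_value gamma n theta v j b) /
             Rpower (arc_dist gamma n a b) sigma).

Definition X_norm (gamma : R -> C) (n : nat) (theta : nat -> R) (sigma : R)
    (v : C -> C) : R :=
  fold_right Rmax 0 (map (arc_norm gamma n theta sigma v) (seq 1 n)).

Definition in_H (gamma : R -> C) (sigma : R) (v : C -> C) : Prop :=
  exists L : R, forall t s : C, on_curve gamma t -> on_curve gamma s ->
    t <> s -> Cmod (v t - v s) <= L * Rpower (Cmod (t - s)) sigma.

Definition H_norm (gamma : R -> C) (sigma : R) (v : C -> C) : R :=
  sup (fun x => exists t : C, on_curve gamma t /\ x = Cmod (v t)) +
  sup (fun x => exists t s : C,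
         on_curve gamma t /\ on_curve gamma s /\ t <> s /\
         x = Cmod (v t - v s) / Rpower (Cmod (t - s)) sigma).

(* The parameter in [0, 2 pi) of a point of the curve. *)
Definition parameter (gamma : R -> C) (t : C) : R :=
  iota (fun s : R_CompleteNormedModule =>
          0 <= s < 2 * PI /\ gamma s = t).

Definition step_generator (gamma : R -> C) (theta : nat -> R) (j : nat)
    (t : C) : R :=
  if Rle_dec (parameter gamma t) (theta j) then 0 else 1.

Definition ramp (gamma : R -> C) (t : C) : R :=
  parameter gamma t / (2 * PI).

Definition generator (gamma : R -> C) (theta : nat -> R) (j : nat)
    (t : C) : R :=
  step_generator gamma theta j t - ramp gamma t.

Definition generator_sum (gamma : R -> C) (n : nat) (theta : nat -> R)
    (c : nat -> C) (t : C) : C :=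
  sum_n_m (fun j => (c j * RtoC (generator gamma theta j t))%C) 1 n.

(* Main.v *)
(** By the chord-arc estimate [|gamma (a + h) - gamma a| >= m * min h (2 pi - h)]
    all the Hölder conditions can be read in the parameter. On the arc that
    starts at [theta j] the sum of the generators with weights [c] is the affine
    function [S_j - S_n s / (2 pi)] with [S_j = c_1 + ... + c_j]; hence
    subtracting it with [c = delta] from the completed values of [v] leaves a
    function that is Hölder on every closed arc and whose values at the common
    endpoints agree, and gluing the finitely many arcs gives a Hölder function on
    a full period. Uniqueness holds because [generator j] has jump 1 at
    [theta j] and a Hölder function has none. *)
Require Import Defs.
From Stdlib Require Import Reals List.
From Stdlib Require Import ZArith Lra Lia Classical.
From Coquelicot Require Import Coquelicot.
Open Scope R_scope.

(** The bound must be uniform in [v], while [in_X] only gives Hölder constants that depend on [v].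
    Those constants serve one purpose: they show that the suprema inside [X_norm] are finite, since
    an infinite supremum would be read as 0 and would control nothing. From then on every estimate
    is [X_norm] times a constant built from [gamma], [n], [theta] and [alpha] alone.

    The chord-arc estimate has two regimes. For small [h] the chord is close to [h] times the
    velocity, which is bounded away from 0 on a period; this uses the second derivatives. For [h]
    between a fixed [eta] and [PI], simplicity makes the chord positive and compactness makes this
    uniform.

    The full period starts at [theta 1] and not at the cut, so that the cut lies inside the last
    arc. The only remaining seam joins [theta 1] to [theta 1 + 2 pi], and periodicity of [gamma]
    closes it. *)

(** * Limits in the complex plane along one-sided filters *)

Lemma filterlim_Cmod {T : Type} (F : (T -> Prop) -> Prop) {FF : Filter F}
    (f : T -> C) (l : C) :
  filterlim f F (locally l) <->
  (forall eps : R, 0 < eps -> F (fun u => Cmod (f u - l)%C < eps)).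
Proof.
  assert (H2 : 0 < sqrt 2) by (apply sqrt_lt_R0; lra).
  split.
  - intros H eps He.
    (* Balls of [C] are squares, from the product uniform structure; the square of half-side
       [eps / sqrt 2] lies in the disc of radius [eps]. *)
    assert (He' : 0 < eps / sqrt 2) by (apply Rdiv_lt_0_compat; assumption).
    generalize (proj1 (filterlim_locally f l) H (mkposreal _ He')).
    apply filter_imp; intros u Hu.
    apply C_NormedModule_mixin_compat2 in Hu; simpl in Hu.
    replace eps with (sqrt 2 * (eps / sqrt 2)) by (field; lra).
    exact Hu.
  - intros H; apply filterlim_locally; intros eps.
    generalize (H eps (cond_pos eps)); apply filter_imp; intros u Hu.
    apply C_NormedModule_mixin_compat1; exact Hu.
Qed.

Lemma Cmod_sym (x y : C) : Cmod (x - y) = Cmod (y - x).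
Proof. rewrite <- Cmod_opp; f_equal; ring. Qed.

Lemma Cmod_triangle_minus (x y z : C) :
  Cmod (x - z) <= Cmod (x - y) + Cmod (y - z).
Proof.
  replace (x - z)%C with ((x - y) + (y - z))%C by ring. apply Cmod_triangle.
Qed.

Lemma Cmod_dist_le (x y : C) : Cmod x <= Cmod (x - y) + Cmod y.
Proof.
  replace x with ((x - y) + y)%C at 1 by ring. apply Cmod_triangle.
Qed.

Lemma filterlim_Cmod_le {T : Type} (F : (T -> Prop) -> Prop)
    {FF : ProperFilter F} (f : T -> C) (l z : C) (B : R) :
  filterlim f F (locally l) -> F (fun u => Cmod (f u - z)%C <= B) ->
  Cmod (l - z) <= B.
Proof.
  intros Hl HB; apply Rnot_lt_le; intros Hlt.
  assert (He : 0 < Cmod (l - z) - B) by lra.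
  destruct (filter_ex _ (filter_and _ _ (proj1 (filterlim_Cmod F f l) Hl _ He) HB))
    as [u [H1 H2]].
  pose proof (Cmod_triangle_minus l (f u) z).
  rewrite (Cmod_sym l (f u)) in H. lra.
Qed.

Lemma at_right_interval (p q : R) : p < q -> at_right p (fun u => p < u < q).
Proof.
  intros H. assert (H' : 0 < q - p) by lra.
  exists (mkposreal _ H'); intros u Hu Hpu; split; [exact Hpu|].
  change (Rabs (u - p) < q - p) in Hu.
  apply Rabs_def2 in Hu; lra.
Qed.

Lemma at_left_interval (p q : R) : p < q -> at_left q (fun u => p < u < q).
Proof.
  intros H. assert (H' : 0 < q - p) by lra.
  exists (mkposreal _ H'); intros u Hu Hpu; split; [|exact Hpu].
  change (Rabs (u - q) < q - p) in Hu.
  apply Rabs_def2 in Hu; lra.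
Qed.

(** Needed at the end [theta 1 + 2 pi] of the last arc, where [in_X] only provides the limit at
    [theta 1]. *)
Lemma filterlim_at_left_shift (f : R -> C) (x T : R) (l : C) :
  (forall s, f (s + T) = f s) ->
  filterlim f (at_left x) (locally l) ->
  filterlim f (at_left (x + T)) (locally l).
Proof.
  intros Hper Hf.
  apply (filterlim_ext (fun s => f (s - T))).
  { intros s. rewrite <- (Hper (s - T)). f_equal; ring. }
  apply (filterlim_comp _ _ _ (fun s => s - T) f _ (at_left x)); [|exact Hf].
  intros P [d Hd]; exists d; intros u Hu Hlt; apply Hd; [|lra].
  change (Rabs (u - (x + T)) < d) in Hu.
  change (Rabs (u - T - x) < d).
  replace (u - T - x) with (u - (x + T)) by ring; exact Hu.
Qed.

Lemma iota_limit (F : (R -> Prop) -> Prop) {FF : ProperFilter' F} (f : R -> C)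
    (l : C) :
  filterlim f F (locally l) ->
  iota (fun y : C_R_CompleteNormedModule => filterlim f F (locally y)) = l.
Proof.
  intros H. apply (iota_unique (V := C_R_CompleteNormedModule)); [|exact H].
  intros y Hy.
  exact (filterlim_locally_unique (V := C_R_NormedModule) f y l Hy H).
Qed.

(** * Hölder estimates on real intervals *)

Lemma Rpower_pos (x a : R) : 0 < Rpower x a.
Proof. apply exp_pos. Qed.

(** Splitting [h] as [h^(1 - alpha) * h^alpha] turns a Lipschitz bound on a bounded interval into a
    Hölder bound. *)
Lemma le_Rpower (h B alpha : R) : 0 < alpha < 1 -> 0 < h <= B ->
  h <= Rpower B (1 - alpha) * Rpower h alpha.
Proof.
  intros Ha Hh.
  apply Rle_trans with (Rpower h (1 - alpha) * Rpower h alpha).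
  - rewrite <- Rpower_plus. replace (1 - alpha + alpha) with 1 by ring.
    rewrite Rpower_1; lra.
  - apply Rmult_le_compat_r; [apply Rlt_le, Rpower_pos|].
    apply Rle_Rpower_l; lra.
Qed.

(** Ordering the two points keeps the base of [Rpower] positive, where it is a genuine power. *)
Definition holder_on (alpha p q K : R) (f : R -> C) : Prop :=
  forall a b : R, p <= a -> a < b -> b <= q ->
    Cmod (f b - f a) <= K * Rpower (b - a) alpha.

(** Points on different sides of [q] are compared through [f q], and both partial distances are at
    most the whole one. Adding the constants is harmless for finitely many arcs. *)
Lemma holder_on_glue (alpha p q r K L : R) (f : R -> C) :
  0 < alpha -> 0 <= K -> 0 <= L ->
  holder_on alpha p q K f -> holder_on alpha q r L f ->
  holder_on alpha p r (K + L) f.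
Proof.
  intros Ha HK HL Hpq Hqr a b Hpa Hab Hbr.
  pose proof (Rpower_pos (b - a) alpha) as HP.
  pose proof (Rmult_le_pos _ _ HK (Rlt_le _ _ HP)).
  pose proof (Rmult_le_pos _ _ HL (Rlt_le _ _ HP)).
  rewrite Rmult_plus_distr_r.
  destruct (Rle_lt_dec b q) as [Hbq|Hqb].
  { pose proof (Hpq a b Hpa Hab Hbq); lra. }
  destruct (Rle_lt_dec q a) as [Hqa|Haq].
  { pose proof (Hqr a b Hqa Hab Hbr); lra. }
  pose proof (Hpq a q Hpa Haq (Rle_refl q)) as H1.
  pose proof (Hqr q b (Rle_refl q) Hqb Hbr) as H2.
  pose proof (Cmod_triangle_minus (f b) (f q) (f a)) as H3.
  assert (H4 : K * Rpower (q - a) alpha <= K * Rpower (b - a) alpha)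
    by (apply Rmult_le_compat_l; [|apply Rle_Rpower_l]; lra).
  assert (H5 : L * Rpower (b - q) alpha <= L * Rpower (b - a) alpha)
    by (apply Rmult_le_compat_l; [|apply Rle_Rpower_l]; lra).
  lra.
Qed.

Lemma holder_on_weaken (alpha p q K L : R) (f : R -> C) :
  K <= L -> holder_on alpha p q K f -> holder_on alpha p q L f.
Proof.
  intros HKL H a b Hpa Hab Hbq.
  apply Rle_trans with (1 := H a b Hpa Hab Hbq).
  apply Rmult_le_compat_r; [apply Rlt_le, Rpower_pos|exact HKL].
Qed.

Lemma holder_on_ext (alpha p q K : R) (f g : R -> C) :
  (forall s, p <= s <= q -> f s = g s) ->
  holder_on alpha p q K f -> holder_on alpha p q K g.
Proof.
  intros He H a b Hpa Hab Hbq. rewrite <- !He by lra. apply H; assumption.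
Qed.

(** Large inequalities survive limits: while a point approaches an endpoint from inside, its
    distance to the other point stays below the limiting distance. The left endpoint is filled in
    before the right one, so that the pair of both endpoints is covered too. *)
Lemma holder_on_closure (alpha p q K : R) (f g : R -> C) (lp lq : C) :
  0 < alpha -> 0 <= K -> p < q ->
  (forall a b, p < a -> a < b -> b < q ->
     Cmod (f b - f a) <= K * Rpower (b - a) alpha) ->
  filterlim f (at_right p) (locally lp) ->
  filterlim f (at_left q) (locally lq) ->
  (forall s, p < s < q -> g s = f s) -> g p = lp -> g q = lq ->
  holder_on alpha p q K g.
Proof.
  intros Ha HK Hpq Hf Hp Hq Hg Hgp Hgq.
  assert (Hmon : forall x y, 0 < x <= y ->
            K * Rpower x alpha <= K * Rpower y alpha).
  { intros x y Hxy. apply Rmult_le_compat_l; [|apply Rle_Rpower_l]; lra. }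
  assert (H1 : forall a b, p <= a -> a < b -> b < q ->
            Cmod (f b - g a) <= K * Rpower (b - a) alpha).
  { intros a b Hpa Hab Hbq.
    destruct (Rle_lt_or_eq_dec _ _ Hpa) as [Hpa'|<-].
    - rewrite Hg by lra. apply Hf; assumption.
    - rewrite Hgp, Cmod_sym.
      apply (filterlim_Cmod_le _ _ _ (f b) _ Hp).
      generalize (at_right_interval p b Hab); apply filter_imp; intros u Hu.
      rewrite Cmod_sym.
      apply Rle_trans with (K * Rpower (b - u) alpha);
        [apply Hf; lra | apply Hmon; lra]. }
  intros a b Hpa Hab Hbq.
  destruct (Rle_lt_or_eq_dec _ _ Hbq) as [Hbq'| ->].
  - rewrite (Hg b) by lra. apply H1; assumption.
  - rewrite Hgq.
    apply (filterlim_Cmod_le _ _ _ (g a) _ Hq).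
    generalize (at_left_interval a q Hab); apply filter_imp; intros u Hu.
    apply Rle_trans with (K * Rpower (u - a) alpha);
      [apply H1; lra | apply Hmon; lra].
Qed.

Lemma holder_on_bounded (alpha p q K : R) (f : R -> C) :
  0 < alpha -> 0 <= K -> holder_on alpha p q K f ->
  forall s, p <= s <= q -> Cmod (f s) <= K * Rpower (q - p) alpha + Cmod (f p).
Proof.
  intros Ha HK H s [Hps Hsq].
  pose proof (Rpower_pos (q - p) alpha) as HP.
  pose proof (Rmult_le_pos _ _ HK (Rlt_le _ _ HP)).
  destruct (Rle_lt_or_eq_dec _ _ Hps) as [Hlt|<-]; [|lra].
  pose proof (Cmod_dist_le (f s) (f p)).
  pose proof (H p s (Rle_refl p) Hlt Hsq).
  assert (K * Rpower (s - p) alpha <= K * Rpower (q - p) alpha)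
    by (apply Rmult_le_compat_l; [|apply Rle_Rpower_l]; lra).
  lra.
Qed.

Lemma holder_on_affine (alpha p q : R) (c d : C) :
  0 < alpha < 1 ->
  holder_on alpha p q (Cmod d * Rpower (q - p) (1 - alpha))
    (fun s => (c + d * RtoC s)%C).
Proof.
  intros Ha a b Hpa Hab Hbq.
  replace (c + d * b - (c + d * a))%C with (d * RtoC (b - a))%C
    by (rewrite RtoC_minus; ring).
  rewrite Cmod_mult, Cmod_R, Rabs_right, Rmult_assoc by lra.
  apply Rmult_le_compat_l; [apply Cmod_ge_0|].
  apply le_Rpower; lra.
Qed.

Lemma holder_on_plus (alpha p q K L : R) (f g : R -> C) :
  holder_on alpha p q K f -> holder_on alpha p q L g ->
  holder_on alpha p q (K + L) (fun s => (f s + g s)%C).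
Proof.
  intros Hf Hg a b Hpa Hab Hbq.
  replace (f b + g b - (f a + g a))%C with ((f b - f a) + (g b - g a))%C by ring.
  rewrite Rmult_plus_distr_r.
  apply Rle_trans with (1 := Cmod_triangle _ _).
  apply Rplus_le_compat; [apply Hf | apply Hg]; assumption.
Qed.

(** * Suprema and finite maxima *)

(** The bound [B] excludes the value plus infinity of [Lub_Rbar E] and the member [x] excludes minus
    infinity, so [real] never returns its default 0. *)
Lemma sup_upper (E : R -> Prop) (B x : R) :
  (forall y, E y -> y <= B) -> E x -> x <= sup E.
Proof.
  intros HB Hx. unfold sup.
  destruct (Lub_Rbar_correct E) as [Hub Hlub].
  specialize (Hub x Hx). specialize (Hlub (Finite B) HB).
  destruct (Lub_Rbar E); simpl in *; try contradiction; assumption.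
Qed.

Lemma sup_le (E : R -> Prop) (B x : R) :
  (forall y, E y -> y <= B) -> E x -> sup E <= B.
Proof.
  intros HB Hx. unfold sup.
  destruct (Lub_Rbar_correct E) as [Hub Hlub].
  specialize (Hub x Hx). specialize (Hlub (Finite B) HB).
  destruct (Lub_Rbar E); simpl in *; try contradiction; assumption.
Qed.

Lemma fold_right_Rmax_le (f : nat -> R) (l : list nat) (j : nat) :
  In j l -> f j <= fold_right Rmax 0 (map f l).
Proof.
  induction l as [|k l IH]; simpl; [tauto|].
  intros [->|H]; [apply Rmax_l|].
  apply Rle_trans with (1 := IH H), Rmax_r.
Qed.

(** * Periodicity and injectivity of the parametrization *)

Lemma contour_periodic_Z (gamma : R -> C) (Hgamma : contour gamma) (k : Z) (s : R) :
  gamma (s + IZR k * (2 * PI)) = gamma s.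
Proof.
  assert (Hnat : forall (m : nat) (x : R), gamma (x + INR m * (2 * PI)) = gamma x).
  { induction m as [|m IH]; intros x.
    - f_equal; simpl; ring.
    - rewrite S_INR, <- (IH x), <- (contour_periodic _ Hgamma (x + INR m * (2 * PI))).
      f_equal; ring. }
  destruct (Z.le_gt_cases 0 k) as [Hk|Hk].
  - rewrite <- (Z2Nat.id k Hk), <- INR_IZR_INZ. apply Hnat.
  - rewrite <- (Hnat (Z.to_nat (- k)) (s + IZR k * (2 * PI))).
    rewrite INR_IZR_INZ, Z2Nat.id, opp_IZR by lia. f_equal; ring.
Qed.

Lemma period_representative (T p s : R) : 0 < T ->
  exists k : Z, p <= s + IZR k * T < p + T.
Proof.
  intros HT. exists (- Int_part ((s - p) / T))%Z.
  destruct (base_Int_part ((s - p) / T)) as [H1 H2].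
  rewrite opp_IZR.
  assert (Hs : s = p + (s - p) / T * T) by (field; lra).
  set (x := (s - p) / T) in *. set (k := IZR (Int_part x)) in *.
  rewrite Hs. split; nra.
Qed.

(** Simplicity is assumed on [[0, 2 pi)] only: whole periods bring [a] there, after which [b]
    exceeds the interval by less than one period. *)
Lemma contour_injective (gamma : R -> C) (Hgamma : contour gamma) (a b : R) :
  a < b < a + 2 * PI -> gamma a <> gamma b.
Proof.
  intros Hab He. pose proof PI_RGT_0 as Hpi.
  destruct (period_representative (2 * PI) 0 a) as [k Hk]; [lra|].
  rewrite <- (contour_periodic_Z _ Hgamma k a),
    <- (contour_periodic_Z _ Hgamma k b) in He.
  destruct (Rlt_le_dec (b + IZR k * (2 * PI)) (2 * PI)) as [Hb|Hb].
  - apply (contour_simple _ Hgamma) in He; lra.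
  - replace (b + IZR k * (2 * PI)) with ((b + IZR k * (2 * PI) - 2 * PI) + 2 * PI)
      in He by ring.
    rewrite (contour_periodic _ Hgamma) in He.
    apply (contour_simple _ Hgamma) in He; lra.
Qed.

(** * The chord-arc estimate and the passage from the parameter to the curve *)

Lemma C2_is_derive (f : R -> R) (s : R) : C2_function f -> is_derive f s (Derive f s).
Proof.
  intros [H _]. apply Derive_correct. exact (H 1%nat s ltac:(lia)).
Qed.

Lemma C2_is_derive_Derive (f : R -> R) (s : R) :
  C2_function f -> is_derive (Derive f) s (Derive_n f 2 s).
Proof.
  intros [H _]. apply Derive_correct. exact (H 2%nat s ltac:(lia)).
Qed.

Lemma C2_continuous_Derive (f : R -> R) (s : R) :
  C2_function f -> continuous (Derive f) s.
Proof.
  intros H. apply (ex_derive_continuous (V := R_NormedModule) (Derive f)). eexists. apply C2_is_derive_Derive, H.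
Qed.

Lemma continuous_bounded (f : R -> R) (p q : R) :
  p <= q -> (forall s, continuous f s) ->
  exists B, 0 <= B /\ forall s, p <= s <= q -> Rabs (f s) <= B.
Proof.
  intros Hpq Hf.
  destruct (continuity_ab_maj (fun s => Rabs (f s)) p q Hpq) as [x [Hx _]].
  { intros c _. apply continuity_pt_filterlim.
    apply (continuous_Rabs_comp f c), Hf. }
  exists (Rabs (f x)); split; [apply Rabs_pos|exact Hx].
Qed.

Lemma derive_lipschitz (f df : R -> R) (p q B : R) :
  (forall s, is_derive f s (df s)) ->
  (forall s, p <= s <= q -> Rabs (df s) <= B) ->
  forall a b, p <= a <= q -> p <= b <= q ->
  Rabs (f b - f a) <= B * Rabs (b - a).
Proof.
  intros Hd HB a b Ha Hb.
  destruct (MVT_gen f a b df) as [c [Hc ->]].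
  - intros x _; apply Hd.
  - intros x _. apply continuity_pt_filterlim, (ex_derive_continuous (V := R_NormedModule) f).
    eexists; apply Hd.
  - rewrite Rabs_mult. apply Rmult_le_compat_r; [apply Rabs_pos|].
    apply HB. revert Hc; unfold Rmin, Rmax; destruct (Rle_dec a b); lra.
Qed.

(** The mean value theorem is applied to [f] and then to [Derive f]; this loses the factor 1/2 of
    Taylor's formula, which is immaterial here. *)
Lemma derive_taylor (f : R -> R) (p q B : R) :
  C2_function f ->
  (forall s, p <= s <= q -> Rabs (Derive_n f 2 s) <= B) ->
  forall a h, p <= a -> 0 <= h -> a + h <= q ->
  Rabs (f (a + h) - f a - Derive f a * h) <= B * h * h.
Proof.
  intros HC HB a h Ha Hh Hq.
  destruct (MVT_gen f a (a + h) (Derive f)) as [c [Hc E]].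
  - intros x _; apply C2_is_derive, HC.
  - intros x _. apply continuity_pt_filterlim, (ex_derive_continuous (V := R_NormedModule) f).
    eexists; apply C2_is_derive, HC.
  - rewrite E. rewrite Rmin_left, Rmax_right in Hc by lra.
    replace (Derive f c * (a + h - a) - Derive f a * h)
      with ((Derive f c - Derive f a) * h) by ring.
    rewrite Rabs_mult, (Rabs_right h) by lra.
    apply Rmult_le_compat_r; [lra|].
    apply Rle_trans with (B * Rabs (c - a)).
    + apply (derive_lipschitz (Derive f) (Derive_n f 2) p q); try lra; auto.
      intros s; apply C2_is_derive_Derive, HC.
    + rewrite Rabs_right by lra. apply Rmult_le_compat_l; [|lra].
      apply Rle_trans with (2 := HB a ltac:(lra)), Rabs_pos.
Qed.

Lemma Cmod_le_abs (x y : R) : Cmod (x, y) <= Rabs x + Rabs y.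
Proof.
  replace ((x, y) : C) with (RtoC x + RtoC y * Ci)%C
    by (unfold RtoC, Cplus, Cmult, Ci; simpl; f_equal; ring).
  apply Rle_trans with (1 := Cmod_triangle _ _).
  rewrite Cmod_mult, Cmod_Ci, !Cmod_R. lra.
Qed.

Lemma contour_lipschitz (gamma : R -> C) (Hgamma : contour gamma) (p q : R) :
  p <= q ->
  exists M, 0 < M /\ forall a b, p <= a <= q -> p <= b <= q ->
    Cmod (gamma b - gamma a) <= M * Rabs (b - a).
Proof.
  intros Hpq.
  destruct Hgamma as [H1 H2 _ _ _ _].
  destruct (continuous_bounded _ p q Hpq (fun s => C2_continuous_Derive _ s H1))
    as [B1 [HB1 HB1']].
  destruct (continuous_bounded _ p q Hpq (fun s => C2_continuous_Derive _ s H2))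
    as [B2 [HB2 HB2']].
  exists (B1 + B2 + 1); split; [lra|]; intros a b Ha Hb.
  pose proof (derive_lipschitz _ _ p q B1 (fun s => C2_is_derive _ s H1) HB1' a b Ha Hb).
  pose proof (derive_lipschitz _ _ p q B2 (fun s => C2_is_derive _ s H2) HB2' a b Ha Hb).
  pose proof (Cmod_le_abs (fst (gamma b) - fst (gamma a)) (snd (gamma b) - snd (gamma a))).
  pose proof (Rabs_pos (b - a)).
  change (Cmod (fst (gamma b) - fst (gamma a), snd (gamma b) - snd (gamma a))
    <= (B1 + B2 + 1) * Rabs (b - a)). simpl in *. nra.
Qed.

Lemma continuous_Cmod_velocity (gamma : R -> C) (Hgamma : contour gamma) (s : R) :
  continuous (fun u => Cmod (velocity gamma u)) s.
Proof.
  destruct Hgamma as [H1 H2 _ _ _ _]. unfold Cmod, velocity; simpl.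
  apply (continuous_comp _ sqrt); [|apply continuous_sqrt].
  apply (continuous_plus (V := R_NormedModule)).
  - apply (continuous_mult (K := R_AbsRing)); [apply C2_continuous_Derive, H1|].
    apply (continuous_mult (K := R_AbsRing)); [apply C2_continuous_Derive, H1|].
    apply continuous_const.
  - apply (continuous_mult (K := R_AbsRing)); [apply C2_continuous_Derive, H2|].
    apply (continuous_mult (K := R_AbsRing)); [apply C2_continuous_Derive, H2|].
    apply continuous_const.
Qed.

Lemma velocity_lower_bound (gamma : R -> C) (Hgamma : contour gamma) (p q : R) :
  p <= q ->
  exists m, 0 < m /\ forall s, p <= s <= q -> m <= Cmod (velocity gamma s).
Proof.
  intros Hpq.
  destruct (continuity_ab_min (fun s => Cmod (velocity gamma s)) p q Hpq)
    as [x [Hx _]].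
  { intros c _. apply continuity_pt_filterlim.
    apply (continuous_Cmod_velocity gamma Hgamma c). }
  exists (Cmod (velocity gamma x)); split; [|exact Hx].
  apply Cmod_gt_0, (contour_regular _ Hgamma).
Qed.

(** The chord differs from [velocity gamma a * h] by at most [(B1 + B2) * h * h], and the velocity
    has modulus at least [m]. The choice of [eta] lets the error consume at most half of [m * h]. *)
Lemma chord_arc_local (gamma : R -> C) (Hgamma : contour gamma) (p q : R) :
  p <= q ->
  exists m eta, 0 < m /\ 0 < eta /\
    forall a h, p <= a -> 0 <= h <= eta -> a + h <= q ->
    m * h <= Cmod (gamma (a + h) - gamma a).
Proof.
  intros Hpq.
  destruct (velocity_lower_bound gamma Hgamma p q Hpq) as [m [Hm Hv]].
  destruct Hgamma as [H1 H2 _ _ _ _].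
  destruct (continuous_bounded _ p q Hpq (proj2 H1)) as [B1 [HB1 HB1']].
  destruct (continuous_bounded _ p q Hpq (proj2 H2)) as [B2 [HB2 HB2']].
  exists (m / 2), (m / (2 * (B1 + B2 + 1))).
  split; [lra|]. split; [apply Rdiv_lt_0_compat; lra|].
  intros a h Ha [Hh Hh'] Hq.
  pose proof (derive_taylor _ p q B1 H1 HB1' a h Ha Hh Hq) as T1.
  pose proof (derive_taylor _ p q B2 H2 HB2' a h Ha Hh Hq) as T2.
  set (x := fun u => fst (gamma u)) in *. set (y := fun u => snd (gamma u)) in *.
  assert (E : (velocity gamma a * RtoC h)%C =
    ((gamma (a + h)%R - gamma a) -
     (x (a + h) - x a - Derive x a * h, y (a + h) - y a - Derive y a * h)%R)%C).
  { unfold velocity; fold x; fold y.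
    unfold Cmult, Cminus, Cplus, Copp, RtoC, x, y; simpl; f_equal; ring. }
  set (r := (x (a + h) - x a - Derive x a * h, y (a + h) - y a - Derive y a * h)%R : C) in *.
  assert (Hr : Cmod r <= (B1 + B2) * h * h)
    by (apply Rle_trans with (1 := Cmod_le_abs _ _); lra).
  assert (Hvel : m * h <= Cmod (velocity gamma a * RtoC h)).
  { rewrite Cmod_mult, Cmod_R, (Rabs_right h) by lra.
    apply Rmult_le_compat_r; [lra|apply Hv; lra]. }
  rewrite E in Hvel.
  assert (Htri : Cmod (gamma (a + h)%R - gamma a - r) <=
            Cmod (gamma (a + h)%R - gamma a) + Cmod r).
  { rewrite <- (Cmod_opp r). apply Cmod_triangle. }
  assert (Hsmall : (B1 + B2 + 1) * h <= m / 2).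
  { apply Rle_trans with ((B1 + B2 + 1) * (m / (2 * (B1 + B2 + 1)))).
    - apply Rmult_le_compat_l; lra.
    - apply Req_le; field; lra. }
  nra.
Qed.

(** A positive lower bound for a positive continuous function on the compact rectangle of pairs
    [(a, h)], drawn from a gauge. *)
Lemma chord_arc_far (gamma : R -> C) (Hgamma : contour gamma) (eta : R) :
  0 < eta ->
  exists m, 0 < m /\
    forall a h, 0 <= a <= 2 * PI -> eta <= h <= PI ->
    m <= Cmod (gamma (a + h)%R - gamma a).
Proof.
  intros Heta. pose proof PI_RGT_0 as Hpi.
  destruct (contour_lipschitz gamma Hgamma 0 (4 * PI)) as [M [HM HL]]; [lra|].
  set (f := fun a h => Cmod (gamma (a + h)%R - gamma a)).
  assert (Hpos : forall a h, eta <= h <= PI -> 0 < f a h).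
  { intros a h Hh. apply Cmod_gt_0. intros E.
    apply (contour_injective gamma Hgamma a (a + h)); [lra|].
    replace (gamma (a + h)) with (gamma (a + h)%R - gamma a + gamma a)%C by ring.
    rewrite E; ring. }
  (* Moving both coordinates by less than [d] changes the chord by at most [3 * M * d], half of its
     value. The value 1 only makes [d] total; it does not occur on the rectangle. *)
  set (d := fun a h => if Rlt_dec 0 (f a h) then f a h / (6 * M) else 1).
  assert (Hd : forall a h, 0 < d a h).
  { intros a h; unfold d; destruct (Rlt_dec 0 (f a h)); [|lra].
    apply Rdiv_lt_0_compat; lra. }
  destruct (compactness_value_2d 0 (2 * PI) eta PI (fun a h => mkposreal _ (Hd a h)))
    as [e He].
  (* At the centre [(u, w)] of a cell the chord is [6 * M * d u w]; at least half of it remains at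
     [(a, h)], and [e <= d u w]. *)
  exists (3 * M * e). split.
  { pose proof (cond_pos e). nra. }
  intros a h Ha Hh.
  destruct (NNPP _ (He a h Ha Hh)) as [u [w [Hu [Hw [H1 [H2 H3]]]]]].
  simpl in H1, H2, H3. unfold d in *.
  pose proof (Hpos u w Hw) as Hf.
  destruct (Rlt_dec 0 (f u w)) as [_|]; [|contradiction].
  assert (HF : f u w = 6 * M * (f u w / (6 * M))) by (field; lra).
  set (t := f u w / (6 * M)) in *.
  pose proof (HL a u ltac:(lra) ltac:(lra)) as L1.
  pose proof (HL (u + w) (a + h) ltac:(lra) ltac:(lra)) as L2.
  rewrite Rabs_minus_sym in L1.
  assert (L3 : Rabs (a + h - (u + w)) <= Rabs (a - u) + Rabs (h - w)).
  { replace (a + h - (u + w)) with ((a - u) + (h - w)) by ring. apply Rabs_triang. }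
  rewrite Cmod_sym in L1.
  pose proof (Cmod_triangle_minus (gamma (u + w)%R) (gamma (a + h)%R) (gamma u)) as T1.
  pose proof (Cmod_triangle_minus (gamma (a + h)%R) (gamma a) (gamma u)) as T2.
  rewrite (Cmod_sym (gamma (u + w)%R) (gamma (a + h)%R)) in T1.
  fold (f u w) in T1. nra.
Qed.

Lemma chord_arc (gamma : R -> C) (Hgamma : contour gamma) :
  exists m, 0 < m /\
    forall a h, 0 <= h <= 2 * PI ->
    m * Rmin h (2 * PI - h) <= Cmod (gamma (a + h)%R - gamma a).
Proof.
  pose proof PI_RGT_0 as Hpi.
  destruct (chord_arc_local gamma Hgamma 0 (4 * PI)) as [m1 [eta [Hm1 [Heta H1]]]]; [lra|].
  destruct (chord_arc_far gamma Hgamma eta Heta) as [m2 [Hm2 H2]].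
  (* The condition [m * PI <= m2] turns the constant bound for [eta <= h <= PI] into one that is
     linear in [h]. *)
  assert (Hm : exists m, 0 < m /\ m <= m1 /\ m * PI <= m2).
  { exists (Rmin m1 (m2 / PI)).
    assert (0 < m2 / PI) by (apply Rdiv_lt_0_compat; lra).
    split; [apply Rmin_glb_lt; lra|]. split; [apply Rmin_l|].
    replace m2 with (m2 / PI * PI) at 2 by (field; lra).
    apply Rmult_le_compat_r; [lra|apply Rmin_r]. }
  destruct Hm as [m [Hm [Hmm1 Hmm2]]].
  assert (Hhalf : forall a h, 0 <= h <= PI -> m * h <= Cmod (gamma (a + h)%R - gamma a)).
  { intros a h Hh.
    destruct (period_representative (2 * PI) 0 a) as [k Hk]; [lra|].
    rewrite <- (contour_periodic_Z _ Hgamma k a),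
      <- (contour_periodic_Z _ Hgamma k (a + h)).
    replace (a + h + IZR k * (2 * PI)) with (a + IZR k * (2 * PI) + h) by ring.
    set (a' := a + IZR k * (2 * PI)) in *.
    destruct (Rle_lt_dec h eta) as [Hle|Hlt].
    - apply Rle_trans with (m1 * h); [nra|]. apply H1; lra.
    - apply Rle_trans with m2; [nra|]. apply H2; lra. }
  exists m; split; [exact Hm|]. intros a h Hh.
  destruct (Rle_lt_dec h PI) as [Hle|Hlt].
  - rewrite Rmin_left by lra. apply Hhalf; lra.
  - rewrite Rmin_right by lra. rewrite Cmod_sym.
    rewrite <- (contour_periodic _ Hgamma a).
    replace (a + 2 * PI) with (a + h + (2 * PI - h)) by ring.
    apply Hhalf; lra.
Qed.

(** [A] is chosen before [f], so it depends on [gamma] and [alpha] only. The factor 2 in it pays for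
    points more than half a period apart: they are compared through the seam, where
    [gamma p = gamma (p + 2 pi)], along two pieces each no longer than [2 pi - (b - a)]. *)
Lemma in_H_of_holder_on (gamma : R -> C) (Hgamma : contour gamma) (alpha : R) :
  0 < alpha ->
  exists A, 0 <= A /\
    forall (p G : R) (f : C -> C), 0 <= G ->
    holder_on alpha p (p + 2 * PI) G (fun s => f (gamma s)) ->
    forall t s, on_curve gamma t -> on_curve gamma s -> t <> s ->
    Cmod (f t - f s)%C <= G * A * Rpower (Cmod (t - s)) alpha.
Proof.
  intros Ha. pose proof PI_RGT_0 as Hpi.
  destruct (chord_arc gamma Hgamma) as [m [Hm Hchord]].
  exists (2 * Rpower (/ m) alpha). split; [pose proof (Rpower_pos (/ m) alpha); lra|].
  intros p G f HG Hf.
  assert (Hmain : forall a b, p <= a -> a < b -> b < p + 2 * PI ->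
    gamma a <> gamma b ->
    Cmod (f (gamma b) - f (gamma a))%C <=
      G * (2 * Rpower (/ m) alpha) * Rpower (Cmod (gamma b - gamma a)) alpha).
  { intros a b Hpa Hab Hb Hne.
    pose proof (Hchord a (b - a) ltac:(lra)) as Hc.
    replace (a + (b - a)) with b in Hc by ring.
    set (d := Cmod (gamma b - gamma a)) in *.
    assert (Hpow : forall x, 0 < x -> m * x <= d ->
      G * Rpower x alpha <= G * (Rpower (/ m) alpha * Rpower d alpha)).
    { intros x Hx Hxd. assert (0 < d) by nra.
      rewrite Rpower_mult_distr by (try assumption; apply Rinv_0_lt_compat, Hm).
      apply Rmult_le_compat_l; [exact HG|]. apply Rle_Rpower_l; [lra|].
      split; [exact Hx|]. apply Rmult_le_reg_l with m; [exact Hm|].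
      rewrite <- Rmult_assoc, Rinv_r by lra. lra. }
    assert (0 <= G * (Rpower (/ m) alpha * Rpower d alpha)).
    { apply Rmult_le_pos; [exact HG|].
      apply Rmult_le_pos; apply Rlt_le, Rpower_pos. }
    destruct (Rle_lt_dec (b - a) PI) as [Hle|Hlt].
    - rewrite Rmin_left in Hc by lra.
      pose proof (Hpow (b - a) ltac:(lra) Hc).
      pose proof (Hf a b Hpa Hab ltac:(lra)). simpl in *. lra.
    - rewrite Rmin_right in Hc by lra.
      pose proof (Hpow (2 * PI - (b - a)) ltac:(lra) Hc) as Hp.
      assert (Hmon : forall x, 0 < x <= 2 * PI - (b - a) ->
        G * Rpower x alpha <= G * Rpower (2 * PI - (b - a)) alpha).
      { intros x Hx. apply Rmult_le_compat_l; [exact HG|]. apply Rle_Rpower_l; lra. }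
      pose proof (Hf b (p + 2 * PI) ltac:(lra) Hb ltac:(lra)) as H1.
      pose proof (Hmon (p + 2 * PI - b) ltac:(lra)).
      assert (H2 : Cmod (f (gamma a) - f (gamma p))%C <=
                   G * Rpower (2 * PI - (b - a)) alpha).
      { destruct (Rle_lt_or_eq_dec _ _ Hpa) as [Hlt'| <-].
        - apply Rle_trans with (1 := Hf p a ltac:(lra) Hlt' ltac:(lra)).
          apply Hmon; lra.
        - replace (f (gamma p) - f (gamma p))%C with (RtoC 0) by ring.
          rewrite Cmod_0. apply Rmult_le_pos; [exact HG|apply Rlt_le, Rpower_pos]. }
      cbv beta in H1, H2. rewrite (contour_periodic _ Hgamma) in H1. rewrite Cmod_sym in H1, H2.
      pose proof (Cmod_triangle_minus (f (gamma b)) (f (gamma p)) (f (gamma a))).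
      lra. }
  intros t s [t' ->] [s' ->] Hts.
  destruct (period_representative (2 * PI) p t') as [k Hk]; [lra|].
  destruct (period_representative (2 * PI) p s') as [l Hl]; [lra|].
  rewrite <- (contour_periodic_Z _ Hgamma k t'), <- (contour_periodic_Z _ Hgamma l s') in *.
  set (a := t' + IZR k * (2 * PI)) in *. set (b := s' + IZR l * (2 * PI)) in *.
  destruct (Rtotal_order a b) as [Hab|[Hab|Hab]].
  - rewrite Cmod_sym, (Cmod_sym (gamma a)). apply Hmain; tauto || lra.
  - rewrite Hab in Hts; congruence.
  - apply Hmain; try lra. intros E; apply Hts; congruence.
Qed.

(** * The arcs and the distance along them *)

(** The last clause says that for several arcs none covers a full period, so the endpoints of an arc
    have distinct images; with one arc it fails, which is why [arc_dist] then measures length. *)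
Lemma arc_range (n : nat) (theta : nat -> R) (Htheta : discontinuities n theta) (j : nat) :
  (1 <= j <= n)%nat ->
  0 < theta 1%nat /\ theta 1%nat <= theta j /\ theta j < 2 * PI /\
  theta j < arc_end n theta j /\
  arc_end n theta j <= theta 1%nat + 2 * PI /\ theta 1%nat < 2 * PI /\
  (n <> 1%nat -> arc_end n theta j < theta j + 2 * PI).
Proof.
  intros Hj. pose proof PI_RGT_0 as Hpi. destruct Htheta as [_ Hr Hi].
  assert (H1 : theta 1%nat <= theta j).
  { destruct (Nat.eq_dec j 1) as [->|]; [lra|]. apply Rlt_le, Hi; lia. }
  pose proof (Hr 1%nat ltac:(lia)). pose proof (Hr j Hj).
  unfold arc_end. destruct (Nat.eqb_spec j n) as [E|E].
  - repeat split; try lra. intros Hn. pose proof (Hi 1%nat j ltac:(lia) ltac:(lia) ltac:(lia)). lra.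
  - pose proof (Hr (S j) ltac:(lia)). pose proof (Hi j (S j) ltac:(lia) ltac:(lia) ltac:(lia)).
    repeat split; lra.
Qed.

Lemma ex_RInt_speed (gamma : R -> C) (Hgamma : contour gamma) (a b : R) :
  ex_RInt (fun u => Cmod (velocity gamma u)) a b.
Proof.
  apply (ex_RInt_continuous (V := R_CompleteNormedModule)).
  intros z _; apply (continuous_Cmod_velocity gamma Hgamma z).
Qed.

Lemma arc_dist_sym (gamma : R -> C) (Hgamma : contour gamma) (n : nat) (a b : R) :
  arc_dist gamma n a b = arc_dist gamma n b a.
Proof.
  unfold arc_dist. destruct (Nat.eqb n 1); [|apply Cmod_sym].
  rewrite <- (opp_RInt_swap (V := R_CompleteNormedModule) _ b a)
    by apply (ex_RInt_speed gamma Hgamma).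
  apply Rabs_Ropp.
Qed.

Lemma arc_dist_upper (gamma : R -> C) (Hgamma : contour gamma) (n : nat) (p q : R) :
  p <= q ->
  exists M, 0 < M /\ forall a b, p <= a -> a < b -> b <= q ->
    arc_dist gamma n a b <= M * (b - a).
Proof.
  intros Hpq. unfold arc_dist. destruct (Nat.eqb n 1).
  - destruct (continuous_bounded (fun u => Cmod (velocity gamma u)) p q Hpq)
      as [B [HB HB']]; [apply continuous_Cmod_velocity, Hgamma|].
    exists (B + 1); split; [lra|]. intros a b Ha Hab Hb. rewrite Rmult_comm.
    apply abs_RInt_le_const; [lra|apply ex_RInt_speed, Hgamma|].
    intros t Ht. pose proof (HB' t ltac:(lra)); lra.
  - destruct (contour_lipschitz gamma Hgamma p q Hpq) as [M [HM HL]].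
    exists M; split; [exact HM|]. intros a b Ha Hab Hb.
    rewrite Cmod_sym. rewrite <- (Rabs_right (b - a)) by lra. apply HL; lra.
Qed.

Lemma arc_dist_lower (gamma : R -> C) (Hgamma : contour gamma) (n : nat) (p q : R) :
  p < q -> (n <> 1%nat -> q < p + 2 * PI) ->
  exists c, 0 < c /\ forall a b, p <= a -> a < b -> b <= q ->
    c * (b - a) <= arc_dist gamma n a b.
Proof.
  intros Hpq Hn. pose proof PI_RGT_0 as Hpi.
  unfold arc_dist. destruct (Nat.eqb_spec n 1) as [E|E].
  - destruct (velocity_lower_bound gamma Hgamma p q) as [m [Hm Hv]]; [lra|].
    exists m; split; [exact Hm|]. intros a b Ha Hab Hb.
    apply Rle_trans with (2 := Rle_abs _).
    replace (m * (b - a)) with (RInt (fun _ => m) a b)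
      by (rewrite RInt_const; apply Rmult_comm).
    apply RInt_le; [lra|apply ex_RInt_const|apply ex_RInt_speed, Hgamma|].
    intros x Hx; apply Hv; lra.
  - specialize (Hn E).
    destruct (chord_arc gamma Hgamma) as [m [Hm Hchord]].
    (* [k] is the fraction of the period left uncovered: both [b - a] and [2 * PI - (b - a)] are at
       least [k * (b - a)]. *)
    set (k := (2 * PI - (q - p)) / (2 * PI)).
    assert (Hk : 0 < k) by (apply Rdiv_lt_0_compat; lra).
    assert (Hk2 : k * (2 * PI) = 2 * PI - (q - p)) by (unfold k; field; lra).
    exists (m * k); split; [nra|]. intros a b Ha Hab Hb.
    specialize (Hchord a (b - a) ltac:(lra)).
    replace (a + (b - a)) with b in Hchord by ring.
    rewrite Cmod_sym. apply Rle_trans with (2 := Hchord).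
    rewrite Rmult_assoc. apply Rmult_le_compat_l; [lra|].
    apply Rmin_glb; nra.
Qed.

(** * Completed arc values and what the norm of [X] controls *)

Section Lateral.

Variables (gamma : R -> C) (n : nat) (theta : nat -> R) (alpha : R) (v : C -> C).
Hypothesis Hgamma : contour gamma.
Hypothesis Htheta : discontinuities n theta.
Hypothesis Halpha : 0 < alpha < 1.
Hypothesis Hv : in_X gamma n theta alpha v.

Lemma outgoing_limit (j : nat) : (1 <= j <= n)%nat ->
  filterlim (fun u => v (gamma u)) (at_right (theta j))
    (locally (outgoing gamma v (theta j))).
Proof.
  intros Hj. destruct (in_X_outgoing _ _ _ _ _ Hv j Hj) as [l Hl].
  unfold outgoing. rewrite (iota_limit (at_right (theta j)) (fun u => v (gamma u)) l Hl).
  exact Hl.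
Qed.

Lemma incoming_theta (j : nat) : (1 <= j <= n)%nat ->
  incoming gamma v (theta j) = v (gamma (theta j)).
Proof.
  intros Hj.
  exact (iota_limit (at_left (theta j)) (fun u => v (gamma u)) _
    (in_X_incoming _ _ _ _ _ Hv j Hj)).
Qed.

Lemma arc_end_limit (j : nat) : (1 <= j <= n)%nat ->
  filterlim (fun u => v (gamma u)) (at_left (arc_end n theta j))
    (locally (v (gamma (arc_end n theta j)))).
Proof.
  intros Hj. unfold arc_end. destruct (Nat.eqb_spec j n) as [E|E].
  - rewrite (contour_periodic _ Hgamma). apply filterlim_at_left_shift.
    + intros s; rewrite (contour_periodic _ Hgamma); reflexivity.
    + apply (in_X_incoming _ _ _ _ _ Hv). lia.
  - apply (in_X_incoming _ _ _ _ _ Hv). lia.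
Qed.

Lemma arc_value_start (j : nat) :
  arc_value gamma n theta v j (theta j) = outgoing gamma v (theta j).
Proof.
  unfold arc_value. destruct (Req_EM_T (theta j) (theta j)); [reflexivity|congruence].
Qed.

(** Since [v] carries its incoming values, completing an arc alters [v] at the left endpoint
    only. *)
Lemma arc_value_eq (j : nat) (s : R) : (1 <= j <= n)%nat -> theta j < s ->
  arc_value gamma n theta v j s = v (gamma s).
Proof.
  intros Hj Hs. unfold arc_value. destruct (Req_EM_T s (theta j)); [lra|].
  destruct (Req_EM_T s (arc_end n theta j)) as [->|]; [|reflexivity].
  exact (iota_limit (at_left (arc_end n theta j)) (fun u => v (gamma u)) _
    (arc_end_limit j Hj)).
Qed.

(** A qualitative statement, with a constant depending on [v]; it provides the finiteness of the
    suprema in [arc_norm]. *)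
Lemma arc_value_holder (j : nat) : (1 <= j <= n)%nat ->
  exists L, 0 <= L /\
    holder_on alpha (theta j) (arc_end n theta j) L (arc_value gamma n theta v j).
Proof.
  intros Hj. pose proof (arc_range n theta Htheta j Hj) as Hr.
  destruct (in_X_holder _ _ _ _ _ Hv j Hj) as [L HL].
  destruct (arc_dist_upper gamma Hgamma n (theta j) (arc_end n theta j)) as [M [HM HM']]; [lra|].
  destruct (arc_dist_lower gamma Hgamma n (theta j) (arc_end n theta j)) as [c [Hc Hc']];
    [lra|tauto|].
  assert (HLM : 0 <= Rabs L * Rpower M alpha).
  { apply Rmult_le_pos; [apply Rabs_pos|apply Rlt_le, Rpower_pos]. }
  exists (Rabs L * Rpower M alpha). split; [exact HLM|].
  apply (holder_on_closure alpha _ _ _ (fun u => v (gamma u)) _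
    (outgoing gamma v (theta j)) (v (gamma (arc_end n theta j)))); try assumption.
  - lra.
  - lra.
  - intros a b Ha Hab Hb. rewrite Cmod_sym.
    apply Rle_trans with (1 := HL a b ltac:(lra) ltac:(lra) ltac:(lra)).
    (* The lower bound makes [arc_dist] positive, as monotonicity of [Rpower] in its base
       requires. *)
    pose proof (Hc' a b ltac:(lra) Hab ltac:(lra)).
    pose proof (HM' a b ltac:(lra) Hab ltac:(lra)).
    assert (0 < c * (b - a)) by (apply Rmult_lt_0_compat; lra).
    rewrite Rmult_assoc, Rpower_mult_distr by lra.
    apply Rle_trans with (Rabs L * Rpower (arc_dist gamma n a b) alpha).
    + apply Rmult_le_compat_r; [apply Rlt_le, Rpower_pos|apply Rle_abs].
    + apply Rmult_le_compat_l; [apply Rabs_pos|]. apply Rle_Rpower_l; lra.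
  - apply outgoing_limit, Hj.
  - apply arc_end_limit, Hj.
  - intros s Hs. apply arc_value_eq; [exact Hj|lra].
  - apply arc_value_start.
  - apply arc_value_eq; [exact Hj|lra].
Qed.

(** Both suprema in [arc_norm] are finite and nonnegative, so each is at most their sum and hence at
    most the maximum over the arcs. *)
Lemma arc_value_X_norm (j : nat) : (1 <= j <= n)%nat ->
  (forall s, theta j <= s <= arc_end n theta j ->
     Cmod (arc_value gamma n theta v j s) <= X_norm gamma n theta alpha v) /\
  (forall a b, theta j <= a -> a < b -> b <= arc_end n theta j ->
     Cmod (arc_value gamma n theta v j b - arc_value gamma n theta v j a)%C <=
     X_norm gamma n theta alpha v * Rpower (arc_dist gamma n a b) alpha).
Proof.
  intros Hj. pose proof (arc_range n theta Htheta j Hj) as Hr.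
  set (F := arc_value gamma n theta v j).
  destruct (arc_value_holder j Hj) as [L [HL HF]]. fold F in HF.
  destruct (arc_dist_lower gamma Hgamma n (theta j) (arc_end n theta j)) as [c [Hc Hc']];
    [lra|tauto|].
  set (E1 := fun x => exists a : R, theta j <= a <= arc_end n theta j /\ x = Cmod (F a)).
  set (E2 := fun x => exists a b : R,
         theta j <= a <= arc_end n theta j /\
         theta j <= b <= arc_end n theta j /\ a <> b /\
         x = Cmod (F a - F b) / Rpower (arc_dist gamma n a b) alpha).
  assert (HX : sup E1 + sup E2 <= X_norm gamma n theta alpha v).
  { apply (fold_right_Rmax_le (arc_norm gamma n theta alpha v)). apply in_seq; lia. }
  assert (B1 : forall y, E1 y -> y <= L * Rpower (arc_end n theta j - theta j) alpha + Cmod (F (theta j))).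
  { intros y [a [Ha ->]]. apply holder_on_bounded; try lra; assumption. }
  assert (B2' : forall a b, theta j <= a -> a < b -> b <= arc_end n theta j ->
    Cmod (F b - F a) / Rpower (arc_dist gamma n a b) alpha <= L * Rpower (/ c) alpha).
  { intros a b Ha Hab Hb.
    pose proof (Hc' a b Ha Hab Hb) as Hd.
    assert (0 < c * (b - a)) by (apply Rmult_lt_0_compat; lra).
    apply Rle_div_l; [apply Rpower_pos|].
    rewrite Rmult_assoc, Rpower_mult_distr by (try apply Rinv_0_lt_compat; lra).
    apply Rle_trans with (1 := HF a b Ha Hab Hb).
    apply Rmult_le_compat_l; [exact HL|]. apply Rle_Rpower_l; [lra|].
    split; [lra|]. apply Rmult_le_reg_l with c; [exact Hc|].
    rewrite <- Rmult_assoc, Rinv_r by lra. lra. }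
  assert (B2 : forall y, E2 y -> y <= L * Rpower (/ c) alpha).
  { intros y [a [b [Ha [Hb [Hne ->]]]]].
    destruct (Rlt_le_dec a b) as [Hab|Hba].
    - rewrite Cmod_sym. apply B2'; lra.
    - rewrite (arc_dist_sym gamma Hgamma). apply B2'; lra. }
  assert (S1 : 0 <= sup E1).
  { apply Rle_trans with (Cmod (F (theta j))); [apply Cmod_ge_0|].
    apply sup_upper with (1 := B1). exists (theta j); split; [lra|reflexivity]. }
  assert (HE2 : forall a b, theta j <= a -> a < b -> b <= arc_end n theta j ->
    Cmod (F b - F a) / Rpower (arc_dist gamma n a b) alpha <= sup E2).
  { intros a b Ha Hab Hb. apply sup_upper with (1 := B2).
    exists b, a. rewrite (arc_dist_sym gamma Hgamma n b a).
    repeat split; lra. }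
  assert (S2 : 0 <= sup E2).
  { apply Rle_trans with (2 := HE2 (theta j) (arc_end n theta j) ltac:(lra) ltac:(lra) ltac:(lra)).
    apply Rdiv_le_0_compat; [apply Cmod_ge_0|apply Rpower_pos]. }
  split.
  - intros s Hs. apply Rle_trans with (sup E1); [|lra].
    apply sup_upper with (1 := B1). exists s; split; [lra|reflexivity].
  - intros a b Ha Hab Hb. apply Rle_div_l; [apply Rpower_pos|].
    apply Rle_trans with (1 := HE2 a b Ha Hab Hb). lra.
Qed.

Lemma X_norm_ge_0 : 0 <= X_norm gamma n theta alpha v.
Proof.
  pose proof (discontinuities_nonempty _ _ Htheta) as Hn.
  pose proof (arc_range n theta Htheta 1 ltac:(lia)) as Hr.
  apply Rle_trans with (2 := proj1 (arc_value_X_norm 1 ltac:(lia)) (theta 1%nat) ltac:(lra)).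
  apply Cmod_ge_0.
Qed.

(** An incoming value belongs to the arc that ends at the point: the preceding arc, or the last one
    when [j] is 1. *)
Lemma value_theta_le (j : nat) : (1 <= j <= n)%nat ->
  Cmod (v (gamma (theta j))) <= X_norm gamma n theta alpha v.
Proof.
  intros Hj.
  assert (Hi : exists i, (1 <= i <= n)%nat /\ gamma (theta j) = gamma (arc_end n theta i)).
  { unfold arc_end. destruct (Nat.eq_dec j 1) as [->|Hj1].
    - exists n. split; [lia|]. rewrite Nat.eqb_refl, (contour_periodic _ Hgamma). reflexivity.
    - exists (pred j). split; [lia|]. destruct (Nat.eqb_spec (pred j) n); [lia|].
      do 2 f_equal. lia. }
  destruct Hi as [i [Hi ->]].
  pose proof (arc_range n theta Htheta i Hi) as Hr.
  rewrite <- (arc_value_eq i _ Hi) by lra.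
  apply arc_value_X_norm; [exact Hi|lra].
Qed.

Lemma jump_eq (j : nat) : (1 <= j <= n)%nat ->
  jump gamma v (theta j) = (outgoing gamma v (theta j) - v (gamma (theta j)))%C.
Proof.
  intros Hj. unfold jump. rewrite incoming_theta by exact Hj. reflexivity.
Qed.

Lemma jump_le (j : nat) : (1 <= j <= n)%nat ->
  Cmod (jump gamma v (theta j)) <= 2 * X_norm gamma n theta alpha v.
Proof.
  intros Hj. rewrite jump_eq by exact Hj.
  pose proof (arc_range n theta Htheta j Hj) as Hr.
  pose proof (proj1 (arc_value_X_norm j Hj) (theta j) ltac:(lra)) as H1.
  rewrite arc_value_start in H1.
  pose proof (value_theta_le j Hj).
  pose proof (Cmod_triangle (outgoing gamma v (theta j)) (- v (gamma (theta j)))%C) as T.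
  rewrite Cmod_opp in T. unfold Cminus. lra.
Qed.

End Lateral.

(** * Sums of generators as affine functions of the parameter *)

Definition partial_sum (c : nat -> C) (j : nat) : C := sum_n_m c 1 j.

Lemma partial_sum_0 (c : nat -> C) : partial_sum c 0 = 0%C.
Proof. unfold partial_sum. rewrite sum_n_m_zero by lia. reflexivity. Qed.

Lemma partial_sum_S (c : nat -> C) (j : nat) :
  partial_sum c (S j) = (partial_sum c j + c (S j))%C.
Proof. unfold partial_sum. rewrite sum_n_Sm by lia. reflexivity. Qed.

Lemma partial_sum_le (c : nat -> C) (B : R) (n : nat) :
  (forall k, (1 <= k <= n)%nat -> Cmod (c k) <= B) ->
  forall j, (j <= n)%nat -> Cmod (partial_sum c j) <= INR j * B.
Proof.
  intros HB j. induction j as [|j IH]; intros Hj.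
  - rewrite partial_sum_0, Cmod_0. simpl; lra.
  - rewrite partial_sum_S, S_INR.
    pose proof (Cmod_triangle (partial_sum c j) (c (S j))).
    pose proof (IH ltac:(lia)). pose proof (HB (S j) ltac:(lia)). lra.
Qed.

(** Here [chi] and [r] stand for the steps and the ramp at one fixed point of the curve, where
    exactly the first [j] steps have been taken. *)
Lemma step_sum (c : nat -> C) (chi : nat -> R) (r : R) (j n : nat) :
  (j <= n)%nat ->
  (forall k, (1 <= k <= j)%nat -> chi k = 1) ->
  (forall k, (j < k <= n)%nat -> chi k = 0) ->
  sum_n_m (fun k => c k * RtoC (chi k - r))%C 1 n =
  (partial_sum c j - partial_sum c n * RtoC r)%C.
Proof.
  intros Hjn H1 H0.
  assert (Hm : forall m, (m <= n)%nat ->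
    sum_n_m (fun k => c k * RtoC (chi k - r))%C 1 m =
    (partial_sum c (Nat.min j m) - partial_sum c m * RtoC r)%C).
  { induction m as [|m IH]; intros Hm.
    - rewrite sum_n_m_zero, Nat.min_0_r, partial_sum_0 by lia.
      change (RtoC 0 = (0 - 0 * r)%C). ring.
    - rewrite sum_n_Sm, IH, (partial_sum_S c m) by lia.
      change (@plus C_AbelianMonoid) with Cplus.
      rewrite RtoC_minus. match goal with |- _ ?x ?y => change (@eq C x y) end.
      destruct (Nat.le_gt_cases (S m) j) as [Hle|Hgt].
      + rewrite (H1 (S m)) by lia. rewrite !Nat.min_r by lia.
        rewrite (partial_sum_S c m). ring.
      + rewrite (H0 (S m)) by lia. rewrite !Nat.min_l by lia. ring. }
  rewrite Hm by lia. rewrite Nat.min_l by lia. reflexivity.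
Qed.

Lemma parameter_eq (gamma : R -> C) (Hgamma : contour gamma) (s : R) :
  0 <= s < 2 * PI -> parameter gamma (gamma s) = s.
Proof.
  intros Hs. apply (iota_unique (V := R_CompleteNormedModule)).
  - intros y [Hy E]. exact (contour_simple _ Hgamma _ _ Hy Hs E).
  - split; [exact Hs|reflexivity].
Qed.

(** The inequality is strict on one side only because of the incoming convention: at [theta k]
    itself the step number [k] is still 0. *)
Lemma generator_sum_step (gamma : R -> C) (Hgamma : contour gamma) (n : nat)
    (theta : nat -> R) (c : nat -> C) (s : R) (j : nat) :
  0 <= s < 2 * PI -> (j <= n)%nat ->
  (forall k, (1 <= k <= j)%nat -> theta k < s) ->
  (forall k, (j < k <= n)%nat -> s <= theta k) ->
  generator_sum gamma n theta c (gamma s) =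
  (partial_sum c j - partial_sum c n * RtoC (s / (2 * PI)))%C.
Proof.
  intros Hs Hj H1 H0. unfold generator_sum, generator, ramp, step_generator.
  rewrite parameter_eq by assumption.
  apply step_sum; [exact Hj| |]; intros k Hk; destruct (Rle_dec s (theta k));
    try reflexivity.
  - specialize (H1 k Hk); lra.
  - specialize (H0 k Hk); lra.
Qed.

Lemma theta_le (n : nat) (theta : nat -> R) (Htheta : discontinuities n theta)
    (i j : nat) :
  (1 <= i)%nat -> (i <= j)%nat -> (j <= n)%nat -> theta i <= theta j.
Proof.
  intros Hi Hij Hj. destruct (Nat.eq_dec i j) as [->|]; [lra|].
  apply Rlt_le, (discontinuities_increasing _ _ Htheta); lia.
Qed.

(** Only [j - 1] steps have been taken at [theta j]. Writing the sum with [partial_sum c j - c j]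
    exhibits [c j] as the gap to the affine formula on the arc that starts there. *)
Lemma generator_sum_theta (gamma : R -> C) (Hgamma : contour gamma) (n : nat)
    (theta : nat -> R) (Htheta : discontinuities n theta) (c : nat -> C) (j : nat) :
  (1 <= j <= n)%nat ->
  generator_sum gamma n theta c (gamma (theta j)) =
  (partial_sum c j - c j - partial_sum c n * RtoC (theta j / (2 * PI)))%C.
Proof.
  intros Hj. pose proof (arc_range n theta Htheta j Hj) as Hr.
  rewrite (generator_sum_step _ Hgamma _ _ _ _ (pred j)); try lra; try lia.
  - replace j with (S (pred j)) at 3 4 by lia.
    rewrite (partial_sum_S c (pred j)).
    replace (S (pred j)) with j by lia. ring.
  - intros k Hk. apply (discontinuities_increasing _ _ Htheta); lia.
  - intros k Hk. apply (theta_le n); try assumption; lia.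
Qed.

(* Across the cut the parameter drops by [2 PI] and all the steps drop to [0]:
   both changes of the sum are [partial_sum c n] up to sign, so that a single
   affine formula holds along the whole last arc. *)
Lemma generator_sum_arc (gamma : R -> C) (Hgamma : contour gamma) (n : nat)
    (theta : nat -> R) (Htheta : discontinuities n theta) (c : nat -> C) (j : nat)
    (s : R) :
  (1 <= j <= n)%nat -> theta j < s <= arc_end n theta j ->
  generator_sum gamma n theta c (gamma s) =
  (partial_sum c j - partial_sum c n * RtoC (s / (2 * PI)))%C.
Proof.
  intros Hj Hs. pose proof PI_RGT_0 as Hpi.
  pose proof (arc_range n theta Htheta j Hj) as Hr.
  destruct (Rlt_le_dec s (2 * PI)) as [Hlt|Hge].
  - apply generator_sum_step; try assumption; try lra; try lia.
    + intros k Hk. apply Rle_lt_trans with (theta j); [|lra].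
      apply (theta_le n); try assumption; lia.
    + intros k Hk. unfold arc_end in Hs. destruct (Nat.eqb_spec j n); [lia|].
      apply Rle_trans with (theta (S j)); [lra|].
      apply (theta_le n); try assumption; lia.
  - assert (E : j = n).
    { destruct (Nat.eq_dec j n) as [E|E]; [exact E|exfalso].
      unfold arc_end in Hs. destruct (Nat.eqb_spec j n); [lia|].
      pose proof (discontinuities_range _ _ Htheta (S j) ltac:(lia)). lra. }
    subst j.
    replace s with ((s - 2 * PI) + 2 * PI) at 1 by ring.
    rewrite (contour_periodic _ Hgamma).
    rewrite (generator_sum_step _ Hgamma _ _ _ _ 0%nat); try lra; try lia.
    + rewrite partial_sum_0.
      replace ((s - 2 * PI) / (2 * PI)) with (s / (2 * PI) - 1) by (field; lra).
      rewrite RtoC_minus. ring.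
    + intros k Hk. apply Rle_trans with (theta 1%nat); [lra|].
      apply (theta_le n); try assumption; lia.
Qed.

(** * Uniqueness of the decomposition *)

Lemma in_H_right_continuous (gamma : R -> C) (Hgamma : contour gamma) (alpha : R)
    (w : C -> C) (s : R) :
  0 < alpha -> in_H gamma alpha w ->
  forall eps, 0 < eps ->
  at_right s (fun u => Cmod (w (gamma u) - w (gamma s))%C < eps).
Proof.
  intros Ha [L HL] eps He.
  destruct (contour_lipschitz gamma Hgamma s (s + 1)) as [M [HM HM']]; [lra|].
  set (L' := Rabs L + 1).
  assert (HL' : 0 < L') by (unfold L'; pose proof (Rabs_pos L); lra).
  (* A chord of length [M * d] is the one at which [L' * chord^alpha] equals [eps / 2]. *)
  set (d := Rpower (eps / (2 * L')) (/ alpha) / M).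
  assert (Hd : 0 < d) by (apply Rdiv_lt_0_compat; [apply Rpower_pos|exact HM]).
  generalize (at_right_interval s (s + Rmin 1 d) ltac:(pose proof (Rmin_glb_lt 1 d 0 ltac:(lra) Hd); lra)).
  apply filter_imp; intros u Hu.
  pose proof (Rmin_l 1 d). pose proof (Rmin_r 1 d).
  destruct (classic (gamma u = gamma s)) as [->|Hne].
  { replace (w (gamma s) - w (gamma s))%C with (RtoC 0) by ring.
    rewrite Cmod_0; exact He. }
  assert (Hc : 0 < Cmod (gamma u - gamma s)).
  { apply Cmod_gt_0; intros E; apply Hne.
    replace (gamma u) with (gamma u - gamma s + gamma s)%C by ring.
    rewrite E; ring. }
  assert (Hc' : Cmod (gamma u - gamma s) <= Rpower (eps / (2 * L')) (/ alpha)).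
  { apply Rle_trans with (M * Rabs (u - s)); [apply HM'; lra|].
    rewrite Rabs_right by lra.
    replace (Rpower (eps / (2 * L')) (/ alpha)) with (M * d) by (unfold d; field; lra).
    apply Rmult_le_compat_l; lra. }
  apply Rle_lt_trans with (1 := HL _ _ (ex_intro _ u eq_refl) (ex_intro _ s eq_refl) Hne).
  apply Rle_lt_trans with (L' * (eps / (2 * L'))).
  - apply Rle_trans with (L' * Rpower (Cmod (gamma u - gamma s)) alpha).
    + apply Rmult_le_compat_r; [apply Rlt_le, Rpower_pos|].
      unfold L'; pose proof (Rle_abs L); lra.
    + apply Rmult_le_compat_l; [lra|].
      assert (0 < eps / (2 * L')) by (apply Rdiv_lt_0_compat; lra).
      rewrite <- (Rpower_1 (eps / (2 * L'))) by assumption.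
      rewrite <- (Rinv_l alpha) by lra. rewrite <- Rpower_mult.
      apply Rle_Rpower_l; lra.
  - replace (L' * (eps / (2 * L'))) with (eps / 2) by (field; lra). lra.
Qed.

(** The outgoing limit of [v] is computed from the given decomposition: [w] tends to its value, the
    sum gains [c j], and the ramp is continuous. Uniqueness of limits identifies the result with
    [outgoing]. *)
Lemma decomposition_jump (gamma : R -> C) (n : nat) (theta : nat -> R) (alpha : R)
    (v w : C -> C) (c : nat -> C) :
  contour gamma -> discontinuities n theta -> 0 < alpha < 1 ->
  in_X gamma n theta alpha v -> in_H gamma alpha w ->
  (forall t, on_curve gamma t -> v t = (w t + generator_sum gamma n theta c t)%C) ->
  forall j, (1 <= j <= n)%nat -> c j = jump gamma v (theta j).
Proof.
  intros Hgamma Htheta Ha Hv Hw Hdec j Hj. pose proof PI_RGT_0 as Hpi.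
  pose proof (arc_range n theta Htheta j Hj) as Hr.
  assert (Hlim : filterlim (fun u => v (gamma u)) (at_right (theta j))
            (locally (v (gamma (theta j)) + c j)%C)).
  { apply (filterlim_Cmod (at_right (theta j))). intros eps He.
    set (D := partial_sum c n).
    (* [B] is the modulus of the slope of the sum on the arc, and [d] keeps its variation within
       [eps / 2]; the added 1 avoids a division by 0. *)
    set (B := Cmod D / (2 * PI)).
    assert (HB : 0 <= B) by (apply Rdiv_le_0_compat; [apply Cmod_ge_0|lra]).
    set (d := eps / 2 / (B + 1)).
    assert (Hd : 0 < d) by (apply Rdiv_lt_0_compat; lra).
    generalize (filter_and (F := at_right (theta j)) _ _
      (in_H_right_continuous gamma Hgamma alpha w (theta j) (proj1 Ha) Hw (eps / 2) ltac:(lra))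
      (filter_and (F := at_right (theta j)) _ _ (at_right_interval (theta j) (arc_end n theta j) ltac:(lra))
         (at_right_interval (theta j) (theta j + d) ltac:(lra)))).
    apply filter_imp. intros u [Hu1 [Hu2 Hu3]].
    rewrite (Hdec (gamma u)), (Hdec (gamma (theta j))) by (eexists; reflexivity).
    rewrite (generator_sum_arc _ Hgamma _ _ Htheta _ j) by (try lia; lra).
    rewrite (generator_sum_theta _ Hgamma _ _ Htheta) by exact Hj. fold D.
    match goal with |- Cmod ?z < _ =>
      replace z with ((w (gamma u) - w (gamma (theta j))) -
        D * RtoC (u / (2 * PI) - theta j / (2 * PI)))%C by (rewrite RtoC_minus; ring) end.
    apply Rle_lt_trans with (1 := Cmod_triangle _ _).
    rewrite Cmod_opp, Cmod_mult, Cmod_R.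
    replace (u / (2 * PI) - theta j / (2 * PI)) with ((u - theta j) / (2 * PI)) by (field; lra).
    rewrite Rabs_right by (apply Rle_ge, Rdiv_le_0_compat; lra).
    replace (Cmod D * ((u - theta j) / (2 * PI))) with (B * (u - theta j))
      by (unfold B; field; lra).
    assert (B * (u - theta j) <= (B + 1) * d) by nra.
    replace ((B + 1) * d) with (eps / 2) in H by (unfold d; field; lra). lra. }
  rewrite (jump_eq gamma n theta alpha v Hv j Hj).
  unfold outgoing. rewrite (iota_limit (at_right (theta j)) (fun u => v (gamma u)) _ Hlim).
  ring.
Qed.

(** * Existence of the continuous part and the norm bound *)

Lemma continuous_part_holder (gamma : R -> C) (n : nat) (theta : nat -> R)
    (alpha : R) :
  contour gamma -> discontinuities n theta -> 0 < alpha < 1 ->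
  exists G, 0 <= G /\ forall v, in_X gamma n theta alpha v ->
  holder_on alpha (theta 1%nat) (theta 1%nat + 2 * PI)
    (G * X_norm gamma n theta alpha v)
    (fun s => v (gamma s) -
      generator_sum gamma n theta (fun j => jump gamma v (theta j)) (gamma s))%C.
Proof.
  intros Hgamma Htheta Ha. pose proof PI_RGT_0 as Hpi.
  pose proof (discontinuities_nonempty _ _ Htheta) as Hn.
  destruct (arc_dist_upper gamma Hgamma n 0 (4 * PI)) as [M [HM HM']]; [lra|].
  (* The first term comes from [arc_dist <= M * (b - a)]. The second bounds the affine part: its
     slope is at most [2 * INR n * N / (2 * PI) <= INR n * N], on an arc of parameter length at most
     [2 * PI]. Gluing [n] arcs then gives the factor [INR n]. *)
  set (K1 := Rpower M alpha + INR n * Rpower (2 * PI) (1 - alpha)).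
  assert (HK1 : 0 <= K1).
  { unfold K1. pose proof (Rpower_pos M alpha). pose proof (Rpower_pos (2 * PI) (1 - alpha)).
    pose proof (pos_INR n). nra. }
  exists (INR n * K1). split; [apply Rmult_le_pos; [apply pos_INR|exact HK1]|].
  intros v Hv.
  set (N := X_norm gamma n theta alpha v).
  assert (HN : 0 <= N) by (apply X_norm_ge_0; assumption).
  set (c := fun j => jump gamma v (theta j)).
  set (D := partial_sum c n).
  assert (HD : Cmod D <= INR n * (2 * N)).
  { apply (partial_sum_le c _ n); [|lia]. intros k Hk. apply jump_le; assumption. }
  set (g := fun s => (v (gamma s) - generator_sum gamma n theta c (gamma s))%C).
  assert (Harc : forall j, (1 <= j <= n)%nat ->
    holder_on alpha (theta j) (arc_end n theta j) (K1 * N) g).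
  { intros j Hj. pose proof (arc_range n theta Htheta j Hj) as Hr.
    set (F := arc_value gamma n theta v j).
    apply (holder_on_ext _ _ _ _
      (fun s => F s + (- partial_sum c j + (D * RtoC (/ (2 * PI))) * RtoC s))%C).
    { intros s Hs. unfold g, F.
      assert (Es : forall x : R, (D * RtoC (/ (2 * PI)) * RtoC x)%C = (D * RtoC (x / (2 * PI)))%C).
      { intros x. unfold Rdiv. rewrite (RtoC_mult x). ring. }
      rewrite Es. destruct (Req_dec s (theta j)) as [->|Hne].
      (* The choice of the jumps as weights enters here: [outgoing] minus [c j] is the value of [v]
         at [theta j], so the affine correction is right at the left endpoint too. *)
      - rewrite arc_value_start.
        rewrite (generator_sum_theta _ Hgamma _ _ Htheta) by exact Hj. fold D.
        unfold c at 3. rewrite (jump_eq gamma n theta alpha v Hv j Hj). ring.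
      - rewrite (arc_value_eq gamma n theta alpha v Hgamma Hv j s Hj) by lra.
        rewrite (generator_sum_arc _ Hgamma _ _ Htheta _ j) by (try lia; lra).
        fold D. ring. }
    apply (holder_on_weaken _ _ _
      (N * Rpower M alpha + Cmod (D * RtoC (/ (2 * PI))) *
         Rpower (arc_end n theta j - theta j) (1 - alpha))).
    { assert (H1 : Cmod (D * RtoC (/ (2 * PI))) <= INR n * N).
      { assert (Hi : 0 < / (2 * PI) <= / 2).
        { split; [apply Rinv_0_lt_compat; lra|]. apply Rinv_le_contravar; [lra|].
          pose proof PI2_1. lra. }
        rewrite Cmod_mult, Cmod_R, (Rabs_right (/ (2 * PI))) by lra.
        pose proof (Cmod_ge_0 D). nra. }
      assert (H2 : Rpower (arc_end n theta j - theta j) (1 - alpha) <=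
                   Rpower (2 * PI) (1 - alpha)) by (apply Rle_Rpower_l; lra).
      pose proof (Rmult_le_compat _ _ _ _ (Cmod_ge_0 (D * RtoC (/ (2 * PI))))
        (Rlt_le _ _ (Rpower_pos (arc_end n theta j - theta j) (1 - alpha))) H1 H2).
      unfold K1. lra. }
    apply holder_on_plus; [|apply holder_on_affine, Ha].
    intros a b Hpa Hab Hb.
    apply Rle_trans with (1 := proj2 (arc_value_X_norm gamma n theta alpha v
      Hgamma Htheta Ha Hv j Hj) a b Hpa Hab Hb).
    fold N. rewrite Rmult_assoc, Rpower_mult_distr by lra.
    apply Rmult_le_compat_l; [exact HN|]. apply Rle_Rpower_l; [lra|].
    destruct (arc_dist_lower gamma Hgamma n (theta j) (arc_end n theta j)) as [k [Hk Hk']];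
      [lra|tauto|].
    pose proof (Hk' a b Hpa Hab Hb). assert (0 < k * (b - a)) by (apply Rmult_lt_0_compat; lra).
    split; [lra|apply HM'; lra]. }
  assert (Hglue : forall j, (1 <= j <= n)%nat ->
    holder_on alpha (theta 1%nat) (arc_end n theta j) (INR j * (K1 * N)) g).
  { assert (HKN : 0 <= K1 * N) by (apply Rmult_le_pos; assumption).
    induction j as [|j IH]; intros Hj; [lia|].
    destruct (Nat.eq_dec j 0) as [->|Hj0].
    - replace (INR 1 * (K1 * N)) with (K1 * N) by (simpl; ring). apply Harc, Hj.
    - rewrite S_INR, Rmult_plus_distr_r, Rmult_1_l.
      apply holder_on_glue with (theta (S j)).
      + lra.
      + apply Rmult_le_pos; [apply pos_INR|exact HKN].
      + exact HKN.
      + specialize (IH ltac:(lia)). unfold arc_end in IH at 1.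
        destruct (Nat.eqb_spec j n); [lia|exact IH].
      + apply Harc, Hj. }
  specialize (Hglue n ltac:(lia)). unfold arc_end in Hglue.
  rewrite Nat.eqb_refl in Hglue. rewrite Rmult_assoc. exact Hglue.
Qed.

Theorem proposition5p3 (gamma : R -> C) (n : nat) (theta : nat -> R)
    (alpha : R)
    (Hgamma : contour gamma) (Htheta : discontinuities n theta)
    (Halpha : 0 < alpha < 1) :
  exists K : R, forall v : C -> C, in_X gamma n theta alpha v ->
  let delta := fun j : nat => jump gamma v (theta j) in
  exists vC : C -> C,
    in_H gamma alpha vC /\
    (forall t : C, on_curve gamma t ->
       v t = (vC t + generator_sum gamma n theta delta t)%C) /\
    (forall (w : C -> C) (c : nat -> C), in_H gamma alpha w ->
       (forall t : C, on_curve gamma t ->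
          v t = (w t + generator_sum gamma n theta c t)%C) ->
       (forall t : C, on_curve gamma t -> w t = vC t) /\
       (forall j : nat, (1 <= j <= n)%nat -> c j = delta j)) /\
    H_norm gamma alpha vC + sum_n_m (fun j => Cmod (delta j)) 1 n <=
      K * X_norm gamma n theta alpha v.
Proof.
  pose proof PI_RGT_0 as Hpi.
  pose proof (discontinuities_nonempty _ _ Htheta) as Hn.
  pose proof (arc_range n theta Htheta 1 ltac:(lia)) as Hr.
  destruct (continuous_part_holder gamma n theta alpha Hgamma Htheta Halpha)
    as [G [HG Hholder]].
  destruct (in_H_of_holder_on gamma Hgamma alpha (proj1 Halpha)) as [A [HA HinH]].
  (* In this order: the oscillation of [vC] over a period, its value at [theta 1], its Hölder
     seminorm, and the sum of the jumps. *)
  exists (G * Rpower (2 * PI) alpha + (1 + 2 * INR n) + G * A + 2 * INR n).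
  intros v Hv delta.
  specialize (Hholder v Hv). fold delta in Hholder.
  set (N := X_norm gamma n theta alpha v) in *.
  assert (HN : 0 <= N) by (apply X_norm_ge_0; assumption).
  assert (HGN : 0 <= G * N) by (apply Rmult_le_pos; assumption).
  assert (Hdelta : forall k, (1 <= k <= n)%nat -> Cmod (delta k) <= 2 * N)
    by (intros k Hk; apply jump_le; assumption).
  set (vC := fun t => (v t - generator_sum gamma n theta delta t)%C).
  specialize (HinH (theta 1%nat) (G * N) vC HGN Hholder).
  exists vC. split; [|split; [|split]].
  - exists (G * N * A). exact HinH.
  - intros t _. unfold vC. ring.
  - intros w c Hw Hdec.
    pose proof (decomposition_jump gamma n theta alpha v w c Hgamma Htheta
      Halpha Hv Hw Hdec) as Hc.
    split; [|exact Hc]. intros t Ht. unfold vC. rewrite (Hdec t Ht).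
    replace (generator_sum gamma n theta delta t) with (generator_sum gamma n theta c t).
    + ring.
    + apply sum_n_m_ext_loc. intros k Hk. rewrite (Hc k Hk). reflexivity.
  - set (p := theta 1%nat) in *.
    assert (Hp : Cmod (vC (gamma p)) <= (1 + 2 * INR n) * N).
    (* Read at [p + 2 * PI], the end of the last arc, the full sum of the jumps cancels and only its
       product with [- p / (2 * PI)] remains. *)
    { unfold vC. rewrite <- (contour_periodic _ Hgamma p).
      rewrite (generator_sum_arc _ Hgamma _ _ Htheta _ n) by
        (try lia; unfold arc_end; rewrite Nat.eqb_refl; fold p;
         pose proof (discontinuities_range _ _ Htheta n ltac:(lia)); lra).
      rewrite (contour_periodic _ Hgamma).
      replace ((p + 2 * PI) / (2 * PI)) with (1 + p / (2 * PI)) by (field; lra).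
      rewrite RtoC_plus.
      match goal with |- Cmod ?z <= _ =>
        replace z with (v (gamma p) + partial_sum delta n * RtoC (p / (2 * PI)))%C by ring end.
      apply Rle_trans with (1 := Cmod_triangle _ _).
      rewrite Cmod_mult, Cmod_R.
      assert (Hq : 0 <= p / (2 * PI) <= 1).
      { split; [apply Rdiv_le_0_compat; lra|]. apply Rle_div_l; lra. }
      rewrite Rabs_right by lra.
      pose proof (value_theta_le gamma n theta alpha v Hgamma Htheta Halpha Hv 1 ltac:(lia)) as H1.
      pose proof (partial_sum_le delta (2 * N) n Hdelta n ltac:(lia)) as H2.
      pose proof (Cmod_ge_0 (partial_sum delta n)). fold p N in H1. nra. }
    assert (HS : sup (fun x => exists t, on_curve gamma t /\ x = Cmod (vC t)) <=
                 G * N * Rpower (2 * PI) alpha + (1 + 2 * INR n) * N).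
    { apply sup_le with (Cmod (vC (gamma p))).
      - intros y [t [[s ->] ->]].
        destruct (period_representative (2 * PI) p s) as [k Hk]; [lra|].
        rewrite <- (contour_periodic_Z _ Hgamma k s).
        pose proof (holder_on_bounded alpha p (p + 2 * PI) (G * N) (fun s => vC (gamma s))
          (proj1 Halpha) HGN Hholder (s + IZR k * (2 * PI)) ltac:(lra)) as HB.
        simpl in HB. replace (p + 2 * PI - p) with (2 * PI) in HB by ring. lra.
      - exists (gamma p). split; [exists p|]; reflexivity. }
    assert (HQ : sup (fun x => exists t s, on_curve gamma t /\ on_curve gamma s /\ t <> s /\
                   x = Cmod (vC t - vC s) / Rpower (Cmod (t - s)) alpha) <= G * N * A).
    (* Two distinct points of the curve witness that the set of quotients is nonempty, as [sup_le]
       asks. *)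
    { apply sup_le with (Cmod (vC (gamma 0) - vC (gamma PI)) /
                         Rpower (Cmod (gamma 0 - gamma PI)) alpha).
      - intros y [t [s [Ht [Hs [Hts ->]]]]]. apply Rle_div_l; [apply Rpower_pos|].
        apply HinH; assumption.
      - exists (gamma 0), (gamma PI). repeat split.
        + exists 0; reflexivity.
        + exists PI; reflexivity.
        + apply (contour_injective gamma Hgamma); lra. }
    assert (HD : sum_n_m (fun j => Cmod (delta j)) 1 n <= 2 * INR n * N).
    { assert (Hm : forall m, (m <= n)%nat ->
        sum_n_m (fun j => Cmod (delta j)) 1 m <= INR m * (2 * N)).
      { induction m as [|m IH]; intros Hm.
        - rewrite sum_n_m_zero by lia. change (0 <= 0 * (2 * N)). lra.
        - rewrite sum_n_Sm, S_INR by lia.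
          change (sum_n_m (fun j => Cmod (delta j)) 1 m + Cmod (delta (S m)) <=
                  (INR m + 1) * (2 * N)).
          pose proof (IH ltac:(lia)). pose proof (Hdelta (S m) ltac:(lia)). lra. }
      specialize (Hm n ltac:(lia)). lra. }
    unfold H_norm. lra.
Qed.
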